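(* Let $\mathcal A,\mathcal B\in R$, and let $(\mathcal A^T*\mathcal A)^{(1)}$ denote an inner inverse of $\mathcal A^T*\mathcal A$. Then the following statements are equivalent: (i) $\mathcal B$ is a $\{1,3\}$-inverse of $\mathcal A$ (i.e. $\mathcal B\in\mathcal A\{1,3\}$). (ii) $\mathcal A^T*\mathcal A*\mathcal B=\mathcal A^T$. (iii) $\mathcal A*\mathcal B=\mathcal A*(\mathcal A^T*\mathcal A)^{(1)}*\mathcal A^T$.
   Context: Fix $p\ge 3$ and positive integers $n,n_3,\dots,n_p$; $R=\mathbb{R}^{n\times n\times n_3\times\cdots\times n_p}$ is the set of real tensors of this size, with entrywise addition. For $\mathcal A\in R$ let $\mathcal A_i$ ($1\le i\le n_p$) be the tensor of order $p-1$ obtained by fixing the last index at $i$. The t-product is defined recursively by $(\mathcal A*\mathcal B)_i=\sum_{j=1}^{n_p}\mathcal A_{i-j+1}*\mathcal B_j$ (indices modulo $n_p$ in $\{1,\dots,n_p\}$), where for matrices $*$ is the ordinary matrix product. The transpose is defined recursively by $(\mathcal A^T)_1=(\mathcal A_1)^T$ and $(\mathcal A^T)_i=(\mathcal A_{n_p+2-i})^T$ for $2\le i\le n_p$, with the ordinary transpose for matrices. With these operations $R$ is an associative ring with unity, and $(\mathcal A*\mathcal B)^T=\mathcal B^T*\mathcal A^T$. An inner inverse of $\mathcal C\in R$ is any $\mathcal C^{(1)}\in R$ with $\mathcal C*\mathcal C^{(1)}*\mathcal C=\mathcal C$. A $\{1,3\}$-inverse of $\mathcal A$ is a $\mathcal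 Z\in R$ with $\mathcal A*\mathcal Z*\mathcal A=\mathcal A$ and $(\mathcal A*\mathcal Z)^T=\mathcal A*\mathcal Z$; $\mathcal A\{1,3\}$ is the set of all of them. *)

(* Defs.v *)
From mathcomp Require Import all_boot all_order all_algebra.
From mathcomp Require Import reals.

Set Implicit Arguments.
Unset Strict Implicit.
Unset Printing Implicit Defensive.

Import GRing.Theory.
Local Open Scope ring_scope.

(* [tensor R n d k] is the additive group of the real tensors of order k + 2
   and size n x n x (d 3) x ... x (d (k + 2)), with entrywise addition; of [d],
   only the values at 3, ..., k + 2 are used.  The outermost finite function is
   indexed by the last mode, so that [A i] is the slice obtained by fixing the
   last index of [A]. *)
Fixpoint tensor (R : realType) (n : nat) (d : nat -> nat) (k : nat) : zmodType :=
  match k with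
  | 0 => 'M[R]_n
  | k'.+1 => {ffun 'I_(d k'.+3) -> tensor R n d k'}
  end.

Lemma ord_pos (m : nat) (i : 'I_m) : (0 < m)%N.
Proof. exact: leq_ltn_trans (leq0n i) (ltn_ord i). Qed.

(* Modes are indexed from 0.  The index i - j + 1 (mod m) of the 1-based
   convention becomes i - j (mod m); the map fixing 1 and sending i to m + 2 - i
   for 2 <= i <= m becomes i |-> - i (mod m). *)
Definition ord_subm (m : nat) (i j : 'I_m) : 'I_m :=
  Ordinal (ltn_pmod (i + (m - j)) (ord_pos i)).

Definition ord_oppm (m : nat) (i : 'I_m) : 'I_m :=
  Ordinal (ltn_pmod (m - i) (ord_pos i)).

Fixpoint tprod (R : realType) (n : nat) (d : nat -> nat) (k : nat) :
    tensor R n d k -> tensor R n d k -> tensor R n d k :=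
  match k with
  | 0 => fun A B => A *m B
  | k'.+1 => fun A B => [ffun i => \sum_j tprod (A (ord_subm i j)) (B j)]
  end.

Fixpoint ttr (R : realType) (n : nat) (d : nat -> nat) (k : nat) :
    tensor R n d k -> tensor R n d k :=
  match k with
  | 0 => fun A => A^T
  | k'.+1 => fun A => [ffun i => ttr (A (ord_oppm i))]
  end.

Declare Scope tensor_scope.
Delimit Scope tensor_scope with tns.
(* The carrier of a zmodType is bound to ring_scope; keep the operands of the
   tensor operations in tensor_scope. *)
Arguments tprod {R n d k} (A B)%_tns : rename.
Arguments ttr {R n d k} A%_tns : rename.
Notation "A * B" := (tprod A B) : tensor_scope.
Notation "A ^T" := (ttr A) : tensor_scope.

Local Open Scope tensor_scope.

Definition inner_inverse (R : realType) (n : nat) (d : nat -> nat) (k : nat)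
    (C X : tensor R n d k) : Prop :=
  C * X * C = C.

Definition inverse13 (R : realType) (n : nat) (d : nat -> nat) (k : nat)
    (A Z : tensor R n d k) : Prop :=
  A * Z * A = A /\ (A * Z)^T = A * Z.

Arguments inner_inverse {R n d k} (C X)%_tns.
Arguments inverse13 {R n d k} (A Z)%_tns.

(* Main.v *)
Require Import Defs.
From HB Require Import structures.
From mathcomp Require Import all_boot all_order all_algebra.
From mathcomp Require Import reals.

Set Implicit Arguments.
Unset Strict Implicit.
Unset Printing Implicit Defensive.

(** With the t-product and the transpose, tensors form a ring with a
    positive involution: a sum of elements [F i ^T * F i] vanishes only if every
    [F i] does ([sum_ttr_tprod_eq0]).  Positivity passes from order k to order
    k + 1 because the slice of index 0 of [A^T * A] is the sum of the
    [A j ^T * A j] over all the slices [A j] of [A], so that a vanishing sum of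
    such products gives a longer one in the lower order; for matrices it is read
    on the diagonal entries, which are sums of squares.

    Positivity allows [A^T] to be cancelled on the left of an equation between
    right multiples of [A] ([ttr_tprod_cancel]), and the rest is algebra in a ring with involution.  Transposing
    [A * B * A = A] gives the normal equation [A^T * A * B = A^T], because
    [A * B] is symmetric.  By the normal equation and its transpose
    [A = B^T * (A^T * A)], the product [A * G * A^T] is
    [B^T * (A^T * A * G * (A^T * A)) * B], in which [G] disappears.  Finally,
    cancelling [A^T] in [A^T * A * G * A^T * A = A^T * A] shows that
    [P = A * G * A^T] fixes [A] ([tprod_inner_fix]); hence [P * P^T = P^T], so
    that [P] is symmetric, and [P] is the required projection [A * B]. *)

Import GRing.Theory Num.Theory.
Local Open Scope ring_scope.
Local Open Scope tensor_scope.

(** * Arithmetic of slice indices modulo m *)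

Lemma ord_submE (m : nat) (i j : 'I_m.+1) : ord_subm i j = i - j.
Proof. by apply: val_inj; rewrite /= modnDmr. Qed.

Lemma ord_oppmE (m : nat) (i : 'I_m.+1) : ord_oppm i = - i.
Proof. exact: val_inj. Qed.

Lemma ord_submBB (m : nat) (i j l : 'I_m) :
  ord_subm (ord_subm i j) (ord_subm l j) = ord_subm i l.
Proof.
case: m i j l => [[] //|m] i j l.
by rewrite !ord_submE opprB addrA subrK.
Qed.

Lemma ord_subm_diag (m : nat) (i j : 'I_m) : ord_subm i (ord_subm j j) = i.
Proof. by case: m i j => [[] //|m] i j; rewrite !ord_submE subrr subr0. Qed.

Lemma ord_oppm_subm (m : nat) (i j : 'I_m) :
  ord_oppm (ord_subm i j) = ord_subm j i.
Proof.
by case: m i j => [[] //|m] i j; rewrite ord_oppmE !ord_submE opprB.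
Qed.

Lemma ord_subm_opp (m : nat) (i j : 'I_m) :
  ord_subm (ord_oppm i) (ord_subm j i) = ord_oppm j.
Proof.
case: m i j => [[] //|m] i j.
by rewrite !ord_oppmE !ord_submE opprB addrA addNr add0r.
Qed.

Lemma ord_oppmK (m : nat) : involutive (@ord_oppm m).
Proof. by case: m => [[] //|m] i; rewrite !ord_oppmE opprK. Qed.

Lemma ord_subm_inj (m : nat) (j : 'I_m) : injective (fun i => ord_subm i j).
Proof.
case: m j => [[] //|m] j i l; rewrite !ord_submE; exact: addIr.
Qed.

(** * Tensors as a ring with involution *)

Section Ring.

Variables (R : realType) (n : nat) (d : nat -> nat).

Fact tprod_is_zmod_morphism k (A : tensor R n d k) :
  zmod_morphism (tprod A).
Proof.
elim: k A => [|k IHk] A X Y /=; first exact: mulmxBr.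
apply/ffunP => i; rewrite !ffunE -sumrB.
by apply: eq_bigr => j _; rewrite !ffunE IHk.
Qed.

HB.instance Definition _ k (A : tensor R n d k) :=
  GRing.isZmodMorphism.Build (tensor R n d k) (tensor R n d k) (tprod A)
    (tprod_is_zmod_morphism A).

(** Naming right multiplication lets it carry its own structure of additive
    morphism. *)
Definition tprodr k (B A : tensor R n d k) : tensor R n d k :=
  (A * B)%tns.

Fact tprodr_is_zmod_morphism k (B : tensor R n d k) :
  zmod_morphism (tprodr B).
Proof.
rewrite /tprodr; elim: k B => [|k IHk] B X Y /=; first exact: mulmxBl.
apply/ffunP => i; rewrite !ffunE -sumrB.
by apply: eq_bigr => j _; rewrite !ffunE IHk.
Qed.

HB.instance Definition _ k (B : tensor R n d k) :=
  GRing.isZmodMorphism.Build (tensor R n d k) (tensor R n d k) (tprodr B)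
    (tprodr_is_zmod_morphism B).

Fact ttr_is_zmod_morphism k : zmod_morphism (@ttr R n d k).
Proof.
elim: k => [|k IHk] X Y /=; first exact: linearB.
by apply/ffunP => i; rewrite !ffunE IHk.
Qed.

HB.instance Definition _ k :=
  GRing.isZmodMorphism.Build (tensor R n d k) (tensor R n d k) (@ttr R n d k)
    (@ttr_is_zmod_morphism k).

Lemma tprod_suml k (I : finType) (F : I -> tensor R n d k) B :
  (\sum_i F i) * B = \sum_i (F i * B)%tns.
Proof. exact: (raddf_sum (tprodr B)). Qed.

Lemma tprodBl k (A B C : tensor R n d k) : (A - B) * C = (A * C)%tns - (B * C)%tns.
Proof. exact: (raddfB (tprodr C)). Qed.

(** The t-product is a cyclic convolution in the last index, so associativity
    is the reindexing [l |-> l - j] of the inner sum. *)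
Lemma tprodA k (A B C : tensor R n d k) : A * (B * C) = A * B * C.
Proof.
elim: k A B C => [|k IHk] A B C /=; first exact: mulmxA.
apply/ffunP => i; rewrite !ffunE.
under eq_bigr => j _ do rewrite ffunE raddf_sum.
rewrite exchange_big; apply: eq_bigr => j _.
rewrite ffunE tprod_suml [RHS](reindex_inj (@ord_subm_inj _ j)).
by apply: eq_bigr => l _; rewrite /= IHk ord_submBB.
Qed.

Lemma ttrK k : involutive (@ttr R n d k).
Proof.
elim: k => [|k IHk] A /=; first exact: trmxK.
by apply/ffunP => i; rewrite !ffunE IHk ord_oppmK.
Qed.

(** Reversal of the order of the factors comes from the reindexing
    [j |-> j - i], which exchanges, up to sign, the slice indices of [A] and
    [B] in the convolution. *)
Lemma ttr_tprod k (A B : tensor R n d k) : (A * B)^T = B^T * A^T.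
Proof.
elim: k A B => [|k IHk] A B /=; first exact: trmx_mul.
apply/ffunP => i; rewrite !ffunE raddf_sum (reindex_inj (@ord_subm_inj _ i)).
by apply: eq_bigr => j _; rewrite /= !ffunE IHk ord_oppm_subm ord_subm_opp.
Qed.

(** * Positivity of the involution *)

Lemma sum_trmx_mul_eq0 (I : finType) (F : I -> 'M[R]_n) :
  \sum_i (F i)^T%R *m F i = 0 -> forall i, F i = 0.
Proof.
move=> F0 i; apply/matrixP => a b; rewrite mxE.
have sq_ge0 i' c c' : 0 <= (F i' c c' ^+ 2)%R by exact: sqr_ge0.
have : \sum_i' \sum_c (F i' c b ^+ 2)%R = 0.
  move/matrixP: F0 => /(_ b b); rewrite summxE mxE => F0; rewrite -[RHS]F0.
  apply: eq_bigr => i' _; rewrite mxE; apply: eq_bigr => c _.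
  by rewrite mxE expr2.
move/eqP; rewrite psumr_eq0 => [/allP/(_ i)|i' _]; last exact: sumr_ge0.
rewrite mem_index_enum /= psumr_eq0 // => /(_ isT)/allP/(_ a).
by rewrite mem_index_enum /= sqrf_eq0 => /(_ isT)/eqP.
Qed.

(** Allowing sums over any finite family, instead of a single [A^T * A], is what
    makes the induction on the order work: the slices of all the members form
    the family in the lower order. *)
Lemma sum_ttr_tprod_eq0 k (I : finType) (F : I -> tensor R n d k) :
  \sum_i ((F i)^T * F i)%tns = 0 -> forall i, F i = 0.
Proof.
elim: k I F => [|k IHk] I F; first exact: sum_trmx_mul_eq0.
move=> F0 i; apply/ffunP => j; rewrite ffunE.
apply: (IHk (I * 'I_(d k.+3))%type (fun u => F u.1 u.2) _ (i, j)).
rewrite -(pair_bigA _ (fun i' j' => (F i' j')^T * F i' j')%tns) /=.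
(* Any index j provides the index 0, as j - j. *)
move/ffunP: F0 => /(_ (ord_subm j j)); rewrite sum_ffunE ffunE => F0.
rewrite -[RHS]F0; apply: eq_bigr => i' _; rewrite !ffunE.
by apply: eq_bigr => l _; rewrite ffunE ord_oppm_subm ord_subm_diag.
Qed.

Lemma ttr_tprod_eq0 k (A : tensor R n d k) : A^T * A = 0 -> A = 0.
Proof.
move=> A0; apply: (@sum_ttr_tprod_eq0 _ unit (fun=> A) _ tt).
by rewrite big_const card_unit /= addr0.
Qed.

(** [Z = A * X - A] has [A^T * Z = 0]; as [Z^T = X^T * A^T - A^T] has a factor
    [A^T] on the right of each term, [Z^T * Z = 0]. *)
Lemma ttr_tprod_cancel k (A X : tensor R n d k) :
  A^T * A * X = A^T * A -> A * X = A.
Proof.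
rewrite -tprodA => AX; apply/eqP; rewrite -subr_eq0; apply/eqP/ttr_tprod_eq0.
have AZ : A^T * ((A * X)%tns - A) = 0 by rewrite raddfB /= AX subrr.
by rewrite [ttr _]raddfB /= ttr_tprod tprodBl -tprodA AZ raddf0 subrr.
Qed.

(** * The projection given by an inner inverse *)

Lemma tprod_inner_fix k (A G : tensor R n d k) :
  inner_inverse (A^T * A) G -> A * G * A^T * A = A.
Proof.
rewrite /inner_inverse => hG; rewrite -!tprodA.
by apply: ttr_tprod_cancel; rewrite tprodA hG.
Qed.

(** [G] itself need not be symmetric.  But [P = A * G * A^T] fixes [A], hence
    also [P^T = A * (G^T * A^T)], so that [P^T = P * P^T] is symmetric. *)
Lemma tprod_inner_sym k (A G : tensor R n d k) :
  inner_inverse (A^T * A) G -> (A * G * A^T)^T = A * G * A^T.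
Proof.
move=> hG; set P := A * G * A^T.
have trP : P^T = P * P^T.
  by rewrite /P !ttr_tprod ttrK !tprodA (tprod_inner_fix hG).
by rewrite -[RHS]ttrK [in RHS]trP ttr_tprod ttrK -trP.
Qed.

(** The normal equation replaces [A^T] by [A^T * A * B] and [A] by
    [B^T * (A^T * A)], which encloses [G] between two copies of [A^T * A]. *)
Lemma normal_eq_tprod k (A B G : tensor R n d k) :
  inner_inverse (A^T * A) G -> A^T * A * B = A^T ->
  A * B = A * G * A^T.
Proof.
rewrite /inner_inverse => hG AB.
have trAB : B^T * (A^T * A) = A.
  by rewrite -[RHS]ttrK -[in RHS]AB !ttr_tprod ttrK.
have -> : A * G * A^T = B^T * (A^T * A) * G * (A^T * A * B) by rewrite trAB AB.
by rewrite (tprodA _ (A^T * A)%tns B) -2!(tprodA (ttr B)) hG trAB.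
Qed.

Lemma inverse13_normal_eq k (A B : tensor R n d k) :
  inverse13 A B -> A^T * A * B = A^T.
Proof. by case=> ABA trAB; rewrite -tprodA -trAB -ttr_tprod ABA. Qed.

End Ring.

Theorem theorem9 (R : realType) (p n : nat) (d : nat -> nat)
    (hp : (3 <= p)%N) (hn : (0 < n)%N)
    (hd : forall i : nat, (3 <= i <= p)%N -> (0 < d i)%N)
    (A B G : tensor R n d p.-2)
    (hG : inner_inverse (A^T * A) G) :
  [<-> inverse13 A B;
       A^T * A * B = A^T;
       A * B = A * G * A^T].
Proof.
tfae.
- exact: inverse13_normal_eq.
- exact: normal_eq_tprod.
- by move=> AB; split; rewrite AB; [exact: tprod_inner_fix|exact: tprod_inner_sym].
Qed.
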